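(* Let $P$ be a poset. For every $P$-stratified cell complex $\mathcal X$ (with cells indexed by $I$) there exists a barycentric subdivision $\Psi$ of $\mathcal X$ that defines a standard neighborhood system on $\mathcal X$. Additionally, for any $P$-stratified space $\mathcal Y$ equipped with a strata-neighborhood system $\mathfrak U_{\mathcal Y}=(U_{\mathcal Y}(p))_{p\in P}$ and any stratum-preserving map $f\colon\mathcal X\to\mathcal Y$, $\Psi$ may be chosen such that $f$ lifts to a map of strata-neighborhood systems $\mathfrak U^\Psi_{\mathcal X}\to\mathfrak U_{\mathcal Y}$, i.e. $f(U^\Psi_{\mathcal X}(p))\subset U_{\mathcal Y}(p)$ for all $p\in P$. Furthermore, if such a subdivision $\Psi_{\mathcal A}$ (that is, one defining a standard neighborhood system on $\mathcal A$ and such that $f|_{\mathcal A}$ lifts to $\mathfrak U^{\Psi_{\mathcal A}}_{\mathcal A}\to\mathfrak U_{\mathcal Y}$) has already been chosen on a stratified subcomplex $\mathcal A\subset\mathcal X$, then $\Psi$ may be taken such that $\Psi_{\mathcal A,i}=\Psi_i$ whenever $i\in I$ defines a cell of $\mathcal A$.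
   Context: $P$ is viewed as a topological space whose closed sets are the downward closed subsets. $\mathbf{Top}$ is a fixed one of: all topological spaces, compactly generated spaces, $\Delta$-generated spaces. A $P$-stratified space $\mathcal X=(X,s_X)$ is $X\in\mathbf{Top}$ with a continuous map $s_X\colon X\to P$; stratum-preserving maps are continuous maps over $P$. Write $X_p=s_X^{-1}(p)$, $X_{\le p}=\{x\mid s_X(x)\le p\}$. A flag is a finite nonempty sequence $\mathcal J=[q_0\le\dots\le q_m]$ in $P$; a subflag is given by a nonempty subset of its entries (with multiplicity). $\Delta^{\mathcal J}$ is $\Delta^m$ with $i\mapsto q_i$; $|\Delta^{\mathcal J}|_s$ is $|\Delta^m|$ with stratification $x\mapsto\max\{q_i\mid x_i>0\}$; $|-|_s$ denotes stratified realization in general. A stratified cell structure on $\mathcal X$ is a family of stratum-preserving maps $(\sigma_i\colon|\Delta^{\mathcal J_i}|_s\to\mathcal X)_{i\in I}$ such that: (i) $X$ has the final topology with respect to the $\sigma_i$; (ii) each $\sigma_i$ restricts to a homeomorphism from $|\Delta^{\mathcal J_i}|_s\setminus|\partial\Delta^{\mathcal J_i}|_s$ onto its image $e_i$; put $\partial e_i=\sigma_i(|\partial\Delta^{\mathcal J_i}|_s)$; (iii) $X$ is the set-theoretic disjoint union of the $e_i$; (iv) the transitive relation $\prec$ on $I$ generated by $i\prec j$ if $e_i\cap\partial e_j\ne\emptyset$ is irreflexive and every element has only finitely many predecessors. A stratified cell complex is a Hausdorff stratified space with a fixed stratified cell structure. A stratified subcomplex is a union of cells $e_i$, $i\in I'$,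 with $I'\subset I$ closed below under $\prec$. $\mathrm{sd}\,\Delta^{\mathcal J}$ is the barycentric subdivision, with vertices the subflags $\mathcal J'\subset\mathcal J$, stratified by $\mathcal J'\mapsto\max\mathcal J'$. A barycentric subdivision $\Psi$ of $\mathcal X$ is a family of stratum-preserving homeomorphisms $\Psi_i\colon|\mathrm{sd}\,\Delta^{\mathcal J_i}|_s\to|\Delta^{\mathcal J_i}|_s$, $i\in I$, with $\Psi_i(|\mathrm{sd}\,\Delta^{\mathcal J}|_s)\subset|\Delta^{\mathcal J}|_s$ for all $\mathcal J\subset\mathcal J_i$. For $p\in P$, $S_{\Delta^{\mathcal J}}(p)\subset\mathrm{sd}\,\Delta^{\mathcal J}$ is the full subcomplex spanned by those subflags $\mathcal J'$ with $p\in\mathcal J'$ or $q<p$ for all $q\in\mathcal J'$; $S_{\partial\Delta^{\mathcal J}}(p)=S_{\Delta^{\mathcal J}}(p)\cap\mathrm{sd}\,\partial\Delta^{\mathcal J}$. $\Psi$ defines a standard neighborhood system on $\mathcal X$ if for all $p\in P$, $i\in I$: $\sigma_i\Psi_i(|S_{\partial\Delta^{\mathcal J_i}}(p)|)\subset\bigcup_{j\prec i}\sigma_j\Psi_j(|S_{\Delta^{\mathcal J_j}}(p)|)$. Then $\mathfrak U^\Psi_{\mathcal X}=(U^\Psi_{\mathcal X}(p))_{p\in P}$ with $U^\Psi_{\mathcal X}(p):=\bigcup_{i\in I}\sigma_i\Psi_i(|S_{\Delta^{\mathcal J_i}}(p)|)$. A $\Delta_P$-neighborhood of $S\subset Y$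 in $\mathcal Y\in\mathbf{Top}_P$ is a subset $U\subset Y$ such that for every flag $\mathcal J$ and every stratum-preserving $\sigma\colon|\Delta^{\mathcal J}|_s\to\mathcal Y$, $\sigma^{-1}(U)$ is a neighborhood of $\sigma^{-1}(S)$. A strata-neighborhood system of $\mathcal Y$ is a family $(U_{\mathcal Y}(p))_{p\in P}$ of subspaces such that $U_{\mathcal Y}(p)$ is a $\Delta_P$-neighborhood of $Y_p$ and $Y_{\le p}\subset U_{\mathcal Y}(p)$. *)

(* Defs.v *)
From HB Require Import structures.
From mathcomp Require Import all_boot all_order all_algebra.
From mathcomp Require Import all_classical all_reals.
From mathcomp Require Import topology normedtype.
From Stdlib Require Import Relation_Operators.
Set Implicit Arguments.
Unset Strict Implicit.
Unset Printing Implicit Defensive.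
Import Order.TTheory GRing.Theory Num.Theory.
Import numFieldNormedType.Exports.
Local Open Scope classical_set_scope.
Local Open Scope ring_scope.

Definition homeomorphism (S T : topologicalType) (f : S -> T) :=
  continuous f /\ exists g : T -> S, [/\ continuous g, cancel f g & cancel g f].

(* [g] is a total function on [T], so this needs [S] to be inhabited, which the
   realizations it is applied to below are. *)
Definition homeomorphism_onto_image (S T : topologicalType) (A : set S)
    (f : S -> T) :=
  {within A, continuous f} /\
  exists g : T -> S, {in A, cancel f g} /\ {within f @` A, continuous g}.

(* A copy of [P] carrying the topology whose closed sets are the downward closed
   subsets (see [poset_closedE]), so as not to conflict with order topologies. *)
Definition poset_space (d : Order.disp_t) (P : porderType d) : Type := P.

Section PosetSpace.
Context (d : Order.disp_t) (P : porderType d).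

Definition upclosed (U : set P) := forall p q : P, (p <= q)%O -> U p -> U q.

Let upT : upclosed setT. Proof. by []. Qed.
Let upI (A B : set P) : upclosed A -> upclosed B -> upclosed (A `&` B).
Proof. by move=> uA uB p q pq [Ap Bp]; split; [exact: uA pq _|exact: uB pq _]. Qed.
Let upU (I : Type) (f : I -> set P) :
  (forall i, upclosed (f i)) -> upclosed (\bigcup_i f i).
Proof. by move=> uf p q pq [i _ fip]; exists i => //; exact: uf pq fip. Qed.

HB.instance Definition _ := Choice.copy (poset_space P) P.
HB.instance Definition _ :=
  @isOpenTopological.Build (poset_space P) upclosed upT upI upU.

Lemma poset_closedE (A : set (poset_space P)) :
  closed A <-> forall p q : P, (p <= q)%O -> A q -> A p.
Proof.
rewrite -openC -[open _]/(upclosed _).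
split=> [uA p q pq Aq|dA p q pq nAp Aq].
  by apply: contrapT => nAp; exact: uA p q pq nAp Aq.
exact: nAp (dA p q pq Aq).
Qed.

Record strat_space := StratSpace {
  strat_carrier :> topologicalType;
  strat : strat_carrier -> poset_space P;
  strat_continuous : continuous strat }.

Definition stratum (X : strat_space) (p : P) : set X := [set x | strat x = p].
Definition stratum_le (X : strat_space) (p : P) : set X :=
  [set x | ((strat x : P) <= p)%O].

Definition stratum_preserving (X Y : strat_space) (f : X -> Y) :=
  continuous f /\ forall x, strat (f x) = strat x.

End PosetSpace.

Arguments stratum {d P} X p x.
Arguments stratum_le {d P} X p x.

Section GreatestLabel.
Context (d : Order.disp_t) (P : porderType d) (V : finType) (lab : V -> P).

Definition greatest (F : {set V}) (p : P) :=
  (exists2 v, v \in F & lab v = p) /\ forall v, v \in F -> (lab v <= p)%O.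

Lemma greatest_exists (F : {set V}) :
  F != finset.set0 -> {in F &, forall v w, (lab v >=< lab w)%O} ->
  exists p, greatest F p.
Proof.
have [n] := ubnP #|F|; elim: n F => // n IH F cF F0 chF.
have [v vF] := set0Pn _ F0.
have [F'0|F'n0] := eqVneq (F :\ v)%SET finset.set0.
  exists (lab v); split; first by exists v.
  move=> w wF; have [->//|wv] := eqVneq w v.
  have : w \in (F :\ v)%SET by rewrite finset.in_setD1 wv.
  by rewrite F'0 finset.in_set0.
have [||p [[u uF' up] pm]] := IH _ _ F'n0.
- by move: cF; rewrite (finset.cardsD1 v F) vF add1n ltnS.
- by move=> a b; rewrite !finset.in_setD1 => /andP[_ aF] /andP[_ bF]; exact: chF.
have uF : u \in F by move: uF'; rewrite finset.in_setD1 => /andP[].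
have /orP[vu|uv] := chF _ _ vF uF.
  exists p; split; first by exists u.
  move=> w wF; have [->|wv] := eqVneq w v; first by rewrite -up.
  by apply: pm; rewrite finset.in_setD1 wv.
exists (lab v); split; first by exists v.
move=> w wF; have [->//|wv] := eqVneq w v.
apply: (le_trans _ uv); rewrite up.
by apply: pm; rewrite finset.in_setD1 wv.
Qed.

Definition max_label (F : {set V}) (F0 : F != finset.set0)
    (chF : {in F &, forall v w, (lab v >=< lab w)%O}) : P :=
  sval (cid (greatest_exists F0 chF)).

Lemma max_labelP F F0 chF : greatest F (@max_label F F0 chF).
Proof. exact: svalP (cid (greatest_exists F0 chF)). Qed.

End GreatestLabel.

(* A finite simplicial complex whose vertices are labelled by elements of [P],
   those of each face forming a chain. The empty set may or may not be listed
   among the faces; this does not matter for the realization. *)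
Record strat_complex (d : Order.disp_t) (P : porderType d) := StratComplex {
  vert : finType;
  faces : {set {set vert}};
  label : vert -> P;
  faces_sub : forall F G : {set vert},
    F \in faces -> G \subset F -> G != finset.set0 -> G \in faces;
  faces_chain : forall F : {set vert}, F \in faces ->
    {in F &, forall v w, (label v >=< label w)%O} }.

Section Realization.
Context (R : realType).

Definition support (V : finType) (x : V -> R) : {set V} := [set v | 0 < x v]%SET.

(* Barycentric coordinates; [K] is the set of faces. *)
Definition realization_set (V : finType) (K : {set {set V}}) : set {ptws V -> R} :=
  [set x | [/\ forall v, 0 <= x v, \sum_v x v = 1 & support x \in K]].

Definition top_realization (V : finType) (K : {set {set V}}) : topologicalType :=
  set_type (realization_set K).

Definition top_simplex (n : nat) : topologicalType :=
  top_realization [set: {set 'I_n.+1}]%SET.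

Context (d : Order.disp_t) (P : porderType d).

Section Stratify.
Variable K : strat_complex P.
Implicit Type x : top_realization (faces K).

Definition supp x : {set vert K} := support (set_val x).

Lemma supp_neq0 x : supp x != finset.set0.
Proof.
have [x0 x1 _] := set_valP x; apply/eqP => s0.
have /eqP : \sum_v set_val x v = 0.
  rewrite big1// => v _; apply/eqP; rewrite eq_le x0 andbT leNgt.
  apply/negP => xv; have : v \in supp x by rewrite finset.inE.
  by rewrite s0 finset.in_set0.
by rewrite x1 oner_eq0.
Qed.

Lemma supp_chain x : {in supp x &, forall v w, (label v >=< label w)%O}.
Proof. by have [_ _] := set_valP x; exact: faces_chain. Qed.

Definition realization_strat x : poset_space P :=
  max_label (supp_neq0 x) (@supp_chain x).

Lemma realization_strat_continuous : continuous realization_strat.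
Proof.
apply/continuousP => A oA.
have -> : realization_strat @^-1` A = \bigcup_(v in [set v | A (label v)])
    (set_val @^-1` ((fun y : {ptws vert K -> R} => y v) @^-1` [set r | 0 < r])).
  apply/seteqP; split=> [x /= Ax|x [v /= Av xv]].
    have [[v vs vE] _] := max_labelP (supp_neq0 x) (@supp_chain x).
    exists v; first by move: Ax; rewrite /realization_strat -vE.
    by move: vs; rewrite finset.inE.
  have [_ mx] := max_labelP (supp_neq0 x) (@supp_chain x).
  by apply: (oA (label v)) => //; apply: mx; rewrite finset.inE.
apply: bigcup_open => v _.
exists ((fun y : {ptws vert K -> R} => y v) @^-1` [set r | 0 < r]) => //.
apply: open_comp; last exact: open_gt.
by move=> y _; exact: proj_continuous.
Qed.

Definition realization : strat_space P :=
  StratSpace realization_strat_continuous.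

(* |L| inside |K|, for a set [L] of faces of [K]. *)
Definition subrealization (L : {set {set vert K}}) : set realization :=
  [set x | supp x \in L].

End Stratify.
End Realization.

Record flag (d : Order.disp_t) (P : porderType d) := Flag {
  flag_dim : nat;
  flag_entry :> 'I_flag_dim.+1 -> P;
  flag_nondecreasing :
    {homo flag_entry : i j / (i <= j)%N >-> (i <= j)%O} }.

Section Simplices.
Context (d : Order.disp_t) (P : porderType d) (J : flag P).

Local Notation idx := 'I_(flag_dim J).+1.

Lemma flag_chain (i j : idx) : (J i >=< J j)%O.
Proof.
by have [ij|/ltnW ji] := leqP i j; [rewrite le_comparable|rewrite ge_comparable];
  rewrite // flag_nondecreasing.
Qed.

Definition simplex : strat_complex P.
Proof.
exists idx [set: {set idx}]%SET J.
- by move=> F G _ _ _; rewrite finset.in_setT.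
- by move=> F _ i j _ _; exact: flag_chain.
Defined.

(* The face of [simplex] spanned by the subflag with index set [A]. *)
Definition simplex_face (A : {set idx}) : {set {set vert simplex}} := powerset A.

Definition simplex_boundary : {set {set vert simplex}} :=
  [set F | F != finset.setT]%SET.

(* Subflags are nonempty sets of indices, not of values, so that entries are
   counted with multiplicity. *)
Definition subflag : finType := {A : {set idx} | A != finset.set0}.

Definition subflag_max (A : subflag) : P :=
  max_label (lab := J) (valP A) (in2W flag_chain).

Lemma subflag_max_le (A B : subflag) :
  val A \subset val B -> (subflag_max A <= subflag_max B)%O.
Proof.
move=> sAB; rewrite /subflag_max.
set hA := valP A; set hB := valP B; set cA := in2W _; set cB := in2W _.
have [[v vA <-] _] := max_labelP hA cA.
by have [_ mB] := max_labelP hB cB; apply: mB; exact: (fintype.subsetP sAB) _ vA.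
Qed.

Definition sd_faces : {set {set subflag}} :=
  [set F : {set subflag} | [forall A in F, forall B in F,
    (val A \subset val B) || (val B \subset val A)]]%SET.

(* The order complex of the poset of subflags. *)
Definition sd : strat_complex P.
Proof.
exists subflag sd_faces subflag_max.
- move=> F G; rewrite !finset.inE => /forall_inP h sGF _.
  apply/forall_inP => A AG; apply/forall_inP => B BG.
  by have /forall_inP := h A (fintype.subsetP sGF _ AG); apply; exact: (fintype.subsetP sGF).
- move=> F; rewrite finset.inE => /forall_inP h A B AF BF.
  have /forall_inP/(_ B BF)/orP[sAB|sBA] := h A AF.
    by rewrite le_comparable// subflag_max_le.
  by rewrite ge_comparable// subflag_max_le.
Defined.

Definition full_subcomplex (W : {set vert sd}) : {set {set vert sd}} :=
  [set F in faces sd | F \subset W]%SET.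

Definition sd_simplex_face (A : {set idx}) : {set {set vert sd}} :=
  full_subcomplex [set B : subflag | val B \subset A]%SET.

Definition sd_boundary : {set {set vert sd}} :=
  [set F in faces sd | [forall B in F, val B != finset.setT]]%SET.

Definition S_simplex (p : P) : {set {set vert sd}} :=
  full_subcomplex [set B : subflag | [exists i in val B, J i == p]
                        || [forall i in val B, (J i < p)%O]]%SET.

Definition S_boundary (p : P) : {set {set vert sd}} :=
  (S_simplex p :&: sd_boundary)%SET.

End Simplices.

Inductive top_category := AllSpaces | CompactlyGenerated | DeltaGenerated.

(* Compactly generated: the topology is final with respect to all continuous
   maps from compact Hausdorff spaces; no separation axiom is included. *)
Definition in_Top (R : realType) (Top : top_category) (X : topologicalType) :=
  match Top with
  | AllSpaces => True
  | CompactlyGenerated => forall U : set X,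
      (forall (K : topologicalType) (u : K -> X),
         compact [set: K] -> hausdorff_space K -> continuous u ->
         open (u @^-1` U)) -> open U
  | DeltaGenerated => forall U : set X,
      (forall (n : nat) (u : top_simplex R n -> X),
         continuous u -> open (u @^-1` U)) -> open U
  end.

Section CellComplexes.
Context (R : realType) (d : Order.disp_t) (P : porderType d).

Record cell_family (X : strat_space P) (I : Type) := CellFamily {
  cell_flag : I -> flag P;
  char_map : forall i, realization R (simplex (cell_flag i)) -> X;
  char_mapP : forall i, stratum_preserving (@char_map i) }.

Arguments char_map [X I] c i x.

Section CellFamily.
Context (X : strat_space P) (I : Type) (C : cell_family X I).

Definition bnd (i : I) : set (realization R (simplex (cell_flag C i))) :=
  subrealization (simplex_boundary (cell_flag C i)).
Arguments bnd i x : clear implicits.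

Definition cell (i : I) : set X := char_map C i @` (~` bnd i).
Definition cell_boundary (i : I) : set X := char_map C i @` bnd i.

Definition prec : I -> I -> Prop :=
  clos_trans I (fun i j => cell i `&` cell_boundary j !=set0).

Record is_cell_structure : Prop := IsCellStructure {
  cell_final : forall U : set X,
    open U <-> forall i, open (char_map C i @^-1` U);
  cell_homeo : forall i, homeomorphism_onto_image (~` bnd i) (char_map C i);
  cell_cover : \bigcup_i cell i = [set: X];
  cell_disjoint : trivIset [set: I] cell;
  prec_irreflexive : forall i, ~ prec i i;
  prec_finite : forall i, finite_set [set j | prec j i] }.

Definition closed_below (D : set I) := forall i j, prec i j -> D j -> D i.

Record barycentric_subdivision := BarycentricSubdivision {
  subdiv_map :> forall i,
    realization R (sd (cell_flag C i)) -> realization R (simplex (cell_flag C i));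
  subdiv_map_strat : forall i, stratum_preserving (@subdiv_map i);
  subdiv_map_homeo : forall i, homeomorphism (@subdiv_map i);
  subdiv_map_face : forall i (A : subflag (cell_flag C i)),
    @subdiv_map i @` subrealization (sd_simplex_face (val A)) `<=`
    subrealization (simplex_face (val A)) }.
Arguments subdiv_map b i x : clear implicits.

Definition S_image (Psi : barycentric_subdivision) (p : P) (i : I) : set X :=
  (char_map C i \o Psi i) @` subrealization (S_simplex (cell_flag C i) p).

Definition standard_nbhd (Psi : barycentric_subdivision) := forall p i,
  (char_map C i \o Psi i) @` subrealization (S_boundary (cell_flag C i) p)
    `<=` \bigcup_(j in [set j | prec j i]) S_image Psi p j.

Definition nbhd_system (Psi : barycentric_subdivision) (p : P) : set X :=
  \bigcup_i S_image Psi p i.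

End CellFamily.

Arguments bnd [X I] C i x.
Arguments subdiv_map [X I C] b i x.

Record cell_structure (X : strat_space P) (I : Type) := CellStructure {
  cells :> cell_family X I;
  cellsP : is_cell_structure cells }.

Section Subspace.
Context (X : strat_space P) (A : set X).

Lemma strat_subspace_continuous : continuous (fun x : A => strat (set_val x)).
Proof.
move=> x; apply: (@continuous_comp A X _ set_val (@strat _ _ X)).
  exact: initial_topology.initial_continuous.
exact: strat_continuous.
Qed.

Definition strat_subspace : strat_space P := StratSpace strat_subspace_continuous.

End Subspace.

Section Subcomplex.
Context (X : strat_space P) (I : Type) (C : cell_structure X I).
Context (D : set I) (HD : closed_below C D).

Definition subcomplex : strat_space P :=
  strat_subspace (\bigcup_(i in D) cell C i).

Lemma char_map_subcomplex (i : D)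
    (x : realization R (simplex (cell_flag C (set_val i)))) :
  (\bigcup_(i in D) cell C i) (char_map C (set_val i) x).
Proof.
have Di := set_valP i; have [bx|nbx] := pselect (bnd C (set_val i) x); last first.
  by exists (set_val i) => //; exists x.
have [k _ ek] : (\bigcup_i cell C i) (char_map C (set_val i) x) 
  by rewrite (cell_cover (cellsP C)).
exists k => //; apply: HD Di; apply: t_step.
by exists (char_map C (set_val i) x); split => //; exists x.
Qed.

Definition subcomplex_char_map (i : D)
    (x : realization R (simplex (cell_flag C (set_val i)))) : subcomplex :=
  exist _ (char_map C (set_val i) x) (mem_set (char_map_subcomplex x)).

Lemma subcomplex_char_mapP (i : D) : stratum_preserving (@subcomplex_char_map i).
Proof.
have [cc cs] := char_mapP C (set_val i).
split=> [|x]; last exact: cs.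
apply/continuousP => _ [B oB <-].
by move/continuousP: cc; apply.
Qed.

Definition subcomplex_cells : cell_family subcomplex D :=
  CellFamily subcomplex_char_mapP.

End Subcomplex.

Definition delta_nbhd (Y : strat_space P) (S U : set Y) :=
  forall (J : flag P) (sigma : realization R (simplex J) -> Y),
    stratum_preserving sigma -> sigma @^-1` S `<=` (sigma @^-1` U)°.

Definition strata_nbhd_system (Y : strat_space P) (U : P -> set Y) :=
  forall p, delta_nbhd (stratum Y p) (U p) /\ stratum_le Y p `<=` U p.

Definition lifts (X Y : strat_space P) (UX : P -> set X) (UY : P -> set Y)
    (f : X -> Y) :=
  forall p, f @` UX p `<=` UY p.

End CellComplexes.

Arguments char_map {R d P X I} c i x.
Arguments bnd {R d P X I} C i x.
Arguments subdiv_map {R d P X I C} b i x.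

(* Main.v *)
Require Import Defs.
From mathcomp Require Import all_boot all_order all_algebra.
From mathcomp Require Import all_classical all_reals.
From mathcomp Require Import topology normedtype derive.
From mathcomp Require Import finmap.
From Stdlib Require Import Relation_Operators.
Set Implicit Arguments.
Unset Strict Implicit.
Unset Printing Implicit Defensive.
Import Order.TTheory GRing.Theory Num.Theory.
Import numFieldNormedType.Exports.
Local Open Scope classical_set_scope.
Local Open Scope ring_scope.

(** Standard neighborhoods on different cells are related only by inclusions: the
subdivisions of two cells never have to agree along a common boundary. They
can therefore be chosen one cell at a time, by recursion along the
well-founded relation [prec], and the cells of a subcomplex can keep the
subdivisions that they already carry. What remains is a statement about a
single simplex, [exists_subdivision_into]: if for every p the set W(p)
contains all strata below or equal to p and is a neighborhood of the stratum
of p, then some subdivision psi maps each |S(p)| into W(p). For the cell i one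
takes for W(p) the preimage of U(p), cut down on the boundary to the points
that sigma_i sends into the standard neighborhoods of the earlier cells. This
set is still a neighborhood of the stratum ([stratum_attaching_target]): for
an earlier cell j, the image of |S(p)| is a neighborhood of the stratum in the
j-th simplex, so the complement of its interior is a compact set avoiding the
stratum; as there are finitely many earlier cells and X is Hausdorff, the
union of the images of these compact sets is closed.

On the simplex with vertices 0, ..., n, a point of |sd| is a weight w on the
nonempty sets of vertices whose support is a chain. The heights
x_i = sum of w(A) over the A containing i identify |sd| with the set of
nonnegative vectors of maximum 1 ([weight_at_inj], [weight_at_surj]), and on
|S(p)| every vertex of positive height with label above p is at most as high
as some vertex with label p ([height_le_of_S_simplex]). Fix a strictly
increasing function eps such that eps(t)/t is nondecreasing and eps(1) is at
most 1/(n+1), and send w to the point with i-th coordinate proportional to the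
(i+1)-st iterate of eps at x_i; normalization then only enlarges coordinates
and preserves inequalities of the form y_i <= eps(y_j). Vertices with
larger labels come later, so a point y of the image of |S(p)| lies in a
stratum below or equal to p, or else there is some j with label p such that
y_i <= eps(y_j) for all i with label above p ([damped_map_thin]): the image is
a cusp around the stratum of p, getting thinner towards the lower strata.
Finally the width that W(p) leaves at distance t from the lower strata is
bounded below by a positive continuous nondecreasing function of t, by
compactness ([exists_gauge_minorant]), and eps is chosen below all these
functions, one for each vertex. *)

(** * Topology of realizations *)

Lemma compact_hausdorff_homeo (S T : topologicalType) (f : S -> T) :
  compact [set: S] -> hausdorff_space T -> continuous f -> injective f ->
  (forall y, exists x, f x = y) -> homeomorphism f.
Proof.
move=> cS hT cf fI fS; split=> //.
pose g y := sval (cid (fS y)).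
have gK : cancel g f by move=> y; exact: svalP (cid (fS y)).
exists g; split=> //; last by move=> x; apply: fI; rewrite gK.
apply/continuous_closedP => A cA.
have -> : g @^-1` A = f @` A.
  apply/seteqP; split=> [y Ay|_ [x Ax <-]] /=; first by exists (g y).
  by rewrite [g _](fI _ x)// gK.
apply: compact_closed => //; apply: continuous_compact.
  exact: continuous_subspaceT.
exact: subclosed_compact cA cS _.
Qed.

Lemma compact_pos_lower_bound (R : realType) (T : topologicalType) (A : set T)
    (f : T -> R) : compact A -> continuous f -> (forall x, A x -> 0 < f x) ->
  exists2 c, 0 < c & forall x, A x -> c <= f x.
Proof.
move=> cA cf f0; have [->|/set0P A0] := eqVneq A set0; first by exists 1.
have [c /set_mem Ac cmin] := compact_EVT_min A0 cA (continuous_subspaceT cf).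
by exists (f c); [exact: f0|move=> x Ax; apply: cmin; exact: mem_set].
Qed.

(** A cluster point that lies in [A] lifts to the subtype, where the topology is
induced from [T]. *)
Lemma set_type_compact (T : topologicalType) (A : set T) :
  compact A -> compact [set: A].
Proof.
move=> cA F FF _.
pose G := fmap (set_val : A -> T) F.
have GA : G A.
  have -> : G A = F setT.
    by congr (F _); apply/seteqP; split=> // a _; exact: set_valP.
  exact: filterT.
have [x [Ax clx]] := cA G _ GA.
exists (exist _ x (mem_set Ax)); split=> // B C FB [U [[W oW <-] Wx] UC].
have GB : G (set_val @` B).
  have FB' : F (set_val @^-1` (set_val @` B)).
    exact: filterS (@preimage_image _ _ _ B) FB.
  exact: FB'.
have [_ [[b Bb <-] Wb]] := clx _ W GB (open_nbhs_nbhs (conj oW Wx)).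
by exists b; split=> //; exact: UC.
Qed.

Lemma continuous_sum (R : realType) (T : topologicalType) (I : Type)
    (r : seq I) (Q : pred I) (f : I -> T -> R) : (forall i, continuous (f i)) ->
  continuous (fun x => \sum_(i <- r | Q i) f i x).
Proof.
by move=> cf; apply: continuous_big => [|i _]; [exact: add_continuous|exact: cf].
Qed.

Lemma continuous_ratio (R : realType) (T : topologicalType) (f g : T -> R) :
  continuous f -> continuous g -> (forall x, g x != 0) ->
  continuous (fun x => f x / g x).
Proof.
by move=> cf cg g0 x; apply: cvgM; [exact: cf|apply: cvgV => //; exact: cg].
Qed.

Lemma in_support (R : realType) (V : finType) (x : V -> R) v :
  (v \in Defs.support x) = (0 < x v).
Proof. by rewrite finset.in_set. Qed.

Section RealizationTopology.
Context (R : realType) (d : Order.disp_t) (P : porderType d) (K : strat_complex P).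
Local Notation RK := (realization R K).

Definition coord (v : vert K) (x : RK) : R := set_val x v.
Arguments coord v x : clear implicits.

Lemma coord_ge0 v (x : RK) : 0 <= coord v x.
Proof. by have [x0 _ _] := set_valP x; exact: x0. Qed.

Lemma coord_sum1 (x : RK) : \sum_v coord v x = 1.
Proof. by have [] := set_valP x. Qed.

Lemma coord_support (x : RK) : supp x \in faces K.
Proof. by have [] := set_valP x. Qed.

Lemma coord_le1 v (x : RK) : coord v x <= 1.
Proof.
by rewrite -(coord_sum1 x) (bigD1 v)//= lerDl sumr_ge0// => w _; exact: coord_ge0.
Qed.

Lemma realization_ext (x y : RK) : coord^~ x =1 coord^~ y -> x = y.
Proof. by move=> xy; apply: val_inj; apply/funext => v; exact: xy. Qed.

Lemma coord_continuous v : continuous (coord v).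
Proof.
move=> x; apply: (@continuous_comp RK {ptws vert K -> R} _ set_val (fun y => y v)).
  exact: initial_topology.initial_continuous.
exact: proj_continuous.
Qed.

Lemma continuous_coord (T : topologicalType) (f : T -> RK) :
  (forall v, continuous (coord v \o f)) -> continuous f.
Proof.
move=> cf; apply: continuous_comp_initial => x.
apply/cvg_sup => v; apply: continuous_comp_initial.
exact: cf.
Qed.

Lemma realization_hausdorff : hausdorff_space RK.
Proof.
move=> x y xy; apply: realization_ext => v.
apply: (@Rhausdorff R) => A B Ax By.
have [||z [Az Bz]] := xy (coord v @^-1` A) (coord v @^-1` B).
- exact: coord_continuous.
- exact: coord_continuous.
by exists (coord v z).
Qed.

(** The realization is a closed part of a cube. Its support condition defines a
closed set because it amounts to a finite disjunction of equations: some face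
[F] exists such that all coordinates outside [F] vanish. *)
Lemma realization_compact : compact [set: RK].
Proof.
pose Q : set {ptws vert K -> R} := [set f | forall v, `[0, 1]%classic (f v)].
have cQ : compact Q.
  apply: (@tychonoff (vert K) (fun=> R) (fun=> `[0, 1]%classic)) => v.
  exact: segment_compact.
apply: set_type_compact; apply: subclosed_compact cQ _; last first.
  move=> x xK v; rewrite /= in_itv/=.
  pose y : RK := exist _ x (mem_set xK).
  by rewrite (coord_ge0 v y) (coord_le1 v y).
have projC v : continuous (fun y : {ptws vert K -> R} => y v).
  exact: proj_continuous.
have -> : realization_set (faces K) =
    \bigcap_v [set x : {ptws vert K -> R} | 0 <= x v] `&`
    [set x | \sum_v x v = 1] `&`
    \bigcup_(F in [set` faces K]) \bigcap_(v in [set v | v \notin F])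
      [set x | x v = 0].
  apply/seteqP; split=> x /=.
    move=> [x0 x1 xK]; split; first by split=> // v _; exact: x0.
    exists (Defs.support x) => // v /=; rewrite in_support -leNgt => xv.
    by apply/eqP; rewrite eq_le xv x0.
  move=> [[x0 x1] [F /= FK xF]]; split=> // [v|]; first exact: x0.
  apply: faces_sub FK _ _; last first.
    apply/eqP => s0; have /eqP := x1; rewrite big1 ?(eq_sym 0) ?oner_eq0// => v _.
    apply/eqP; rewrite eq_le x0// leNgt; apply/andP; split=> //.
    by apply/negP; rewrite -in_support s0 finset.inE.
  apply/fintype.subsetP => v; rewrite in_support => xv.
  by apply: contraTT xv => /xF/= ->; rewrite ltxx.
apply: closedI; first apply: closedI.
- apply: closed_bigI => v _.
  apply: (@preimage_closed _ _
    (fun y : {ptws vert K -> R} => y v) [set r | 0 <= r]).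
    by move=> x _; exact: projC.
  exact: closed_ge.
- apply: (@preimage_closed _ _ (fun y : {ptws vert K -> R} => \sum_v y v) [set 1]).
    by move=> x _; exact: (continuous_sum projC).
  exact: closed_eq.
- apply: closed_bigcup; first exact: finite_finset.
  move=> F _; apply: closed_bigI => v _.
  apply: (@preimage_closed _ _ (fun y : {ptws vert K -> R} => y v) [set 0]).
    by move=> x _; exact: projC.
  exact: closed_eq.
Qed.
End RealizationTopology.

Arguments coord {R d P K} v x.

Section Strata.
Context (R : realType) (d : Order.disp_t) (P : porderType d).

Lemma greatest_unique (V : finType) (lab : V -> P) F p q :
  greatest lab F p -> greatest lab F q -> p = q.
Proof.
move=> [[v vF <-] pm] [[w wF <-] qm]; apply/eqP.
by rewrite eq_le pm// qm.
Qed.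

Lemma strat_greatest (K : strat_complex P) (x : realization R K) :
  greatest (@label d P K) (supp x) (strat x).
Proof. exact: max_labelP. Qed.

Lemma subflag_max_greatest (J : flag P) (A : subflag J) :
  greatest J (val A) (subflag_max A).
Proof. exact: max_labelP. Qed.
End Strata.

(** * Weights supported on chains of subsets *)

Section ChainWeights.
Context (R : realType) (T : finType).
Local Notation nset := {A : {set T} | A != finset.set0}.
Implicit Types (w : nset -> R) (x : T -> R) (A B : nset).

(** The points of the order complex of the nonempty subsets of [T], before
normalization of the total weight. *)
Definition chain_weight w :=
  (forall A, 0 <= w A) /\
  forall A B, 0 < w A -> 0 < w B -> (val A \subset val B) || (val B \subset val A).

Definition weight_at w (i : T) : R := \sum_(A : nset | i \in val A) w A.

Lemma weight_at_ge0 w i : chain_weight w -> 0 <= weight_at w i.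
Proof. by case=> w0 _; apply: sumr_ge0. Qed.

Lemma weight_at_gt0 w i : chain_weight w ->
  0 < weight_at w i <-> exists2 A, 0 < w A & i \in val A.
Proof.
case=> w0 _; split=> [|[A wA iA]].
  apply: contraPP => none; rewrite /weight_at big1 ?ltxx// => A iA.
  apply/eqP; rewrite eq_le w0 andbT leNgt; apply/negP => wA.
  by apply: none; exists A.
rewrite /weight_at (bigD1 A)//= ltr_pwDl// sumr_ge0//.
Qed.

Lemma weight_at_le w i : chain_weight w -> weight_at w i <= \sum_A w A.
Proof.
case=> w0 _; rewrite [leRHS](bigID (fun A => i \in val A))/= lerDl sumr_ge0//.
Qed.

(** Every element of the smallest set of the chain belongs to all sets of the
chain, so it sees the whole weight. *)
Lemma weight_at_eq_sum w : chain_weight w -> (exists A, 0 < w A) ->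
  exists i, weight_at w i = \sum_A w A.
Proof.
move=> [w0 wc] [A0 wA0].
case: (@arg_minnP _ A0 (fun A => 0 < w A) (fun A => #|val A|) wA0) => A wA Amin.
have [i iA] := set0Pn _ (valP A); exists i.
rewrite [RHS](bigID (fun B => i \in val B))/= [X in _ + X]big1 ?addr0// => B iB.
apply/eqP; rewrite eq_le w0 andbT leNgt; apply/negP => wB.
case/orP: (wc A B wA wB) => [/fintype.subsetP/(_ i iA)|sBA]; first by apply/negP.
have /eqP/setP/(_ i) : val B == val A by rewrite finset.eqEcard sBA Amin.
by rewrite iA (negbTE iB).
Qed.

(** The union of the sets of a chain that do not contain [A] is again one of
them, so it misses some element of [A]. *)
Lemma chain_weight_isolating w A : chain_weight w ->
  exists2 i, i \in val A & forall B, 0 < w B -> i \in val B -> val A \subset val B.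
Proof.
move=> [w0 wc].
have [|none] := pselect (exists B, (0 < w B) && ~~ (val A \subset val B)).
  case=> B0 B0P.
  case: (@arg_maxnP _ B0 (fun B => (0 < w B) && ~~ (val A \subset val B))
    (fun B => #|val B|) B0P) => B /andP[wB nAB] Bmax.
  have /fintype.subsetPn[i iA iB] := nAB; exists i => // C wC iC.
  apply: contraT => nAC; case/orP: (wc B C wB wC) => [sBC|/fintype.subsetP/(_ i iC)].
    have /eqP/setP/(_ i) : val B == val C.
      by rewrite finset.eqEcard sBC; apply: Bmax; rewrite wC.
    by rewrite iC (negbTE iB).
  by rewrite (negbTE iB).
have [i iA] := set0Pn _ (valP A); exists i => // B wB _.
by apply: contraT => nAB; exfalso; apply: none; exists B; rewrite wB.
Qed.

(** By [chain_weight_isolating] the total weight of the sets above [A] is the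
minimum over [A] of [weight_at w]; it is thus determined by [weight_at w]. *)
Lemma weight_above_le w w' A : chain_weight w -> chain_weight w' ->
    weight_at w =1 weight_at w' ->
  \sum_(B : nset | val A \subset val B) w B <=
  \sum_(B : nset | val A \subset val B) w' B.
Proof.
move=> cw cw' ww'.
have [i iA iw'] := chain_weight_isolating A cw'.
apply: (@le_trans _ _ (weight_at w i)).
  rewrite /weight_at [leRHS](bigID (fun B => val A \subset val B))/=.
  rewrite [X in X + _](eq_bigl (fun B : nset => val A \subset val B)); last first.
    by move=> B; apply: andb_idl => /fintype.subsetP; exact.
  by rewrite lerDl sumr_ge0// => B _; exact: (cw.1 B).
rewrite ww' /weight_at [leLHS](bigID (fun B => val A \subset val B))/=.
rewrite [X in _ + X]big1 ?addr0 => [|B /andP[iB nAB]]; last first.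
  apply/eqP; rewrite eq_le (cw'.1 B) andbT leNgt; apply/negP => wB.
  by move: nAB; rewrite iw'.
rewrite le_eqVlt; apply/orP; left; apply/eqP; apply: eq_bigl => B.
by apply: andb_idl => /fintype.subsetP; exact.
Qed.

(** The total weights above the sets determine the weight, by induction from
large sets to small ones. *)
Lemma weight_at_inj w w' : chain_weight w -> chain_weight w' ->
  weight_at w =1 weight_at w' -> w =1 w'.
Proof.
move=> cw cw' ww' A.
have [n] := ubnP (#|~: val A|)%SET; elim: n A => // n IH A; rewrite ltnS => An.
have : \sum_(B : nset | val A \subset val B) w B =
       \sum_(B : nset | val A \subset val B) w' B.
  by apply/eqP; rewrite eq_le !weight_above_le.
rewrite [in LHS](bigD1 A)//= [in RHS](bigD1 A)//=.
rewrite (eq_bigr w'); first by move/addIr.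
move=> B /andP[sAB BA]; apply: IH; apply: leq_trans An.
apply: proper_card; rewrite finset.properC finset.properEneq sAB andbT.
by rewrite eq_sym; apply: contra_neq BA => /val_inj.
Qed.

(** The smallest set [A] of the chain that contains [i] works: each set of the
chain that contains [i] contains all of [A]. *)
Lemma weight_at_dominated w i : chain_weight w -> 0 < weight_at w i ->
  exists A, [/\ 0 < w A, i \in val A &
    forall j, j \in val A -> weight_at w i <= weight_at w j].
Proof.
move=> cw /(weight_at_gt0 _ cw)[A0 wA0 iA0].
have P0 : (0 < w A0) && (i \in val A0) by rewrite wA0.
case: (@arg_minnP _ A0 (fun A => (0 < w A) && (i \in val A))
  (fun A => #|val A|) P0) => A /andP[wA iA] Amin.
exists A; split=> // j jA.
rewrite /weight_at [leRHS](bigID (fun B => i \in val B))/=.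
rewrite [leLHS](bigID (fun B => j \in val B))/= [X in _ + X <= _]big1 ?addr0.
  rewrite (eq_bigl (fun B : nset => (j \in val B) && (i \in val B))).
    by rewrite lerDl sumr_ge0// => B _; exact: cw.1.
  by move=> B; rewrite andbC.
move=> B /andP[iB jB]; apply/eqP; rewrite eq_le (cw.1 B) andbT leNgt.
apply/negP => wB; move: jB; apply/negP; rewrite negbK.
have [/fintype.subsetP/(_ j jA)//|sBA] := orP (cw.2 A B wA wB).
have /eqP/setP/(_ j) : val B == val A.
  by rewrite finset.eqEcard sBA; apply: Amin; rewrite wB.
by rewrite jA.
Qed.

(** Layer by layer: the smallest positive value of [x] is the weight of the
support of [x], and subtracting it there leaves a function with smaller
support. *)
Lemma weight_at_surj x : (forall i, 0 <= x i) ->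
  exists2 w, chain_weight w & weight_at w =1 x.
Proof.
have [n] := ubnP #|Defs.support x|; elim: n x => // n IH x; rewrite ltnS => xn x0.
have [S0|Sn0] := eqVneq (Defs.support x) finset.set0.
  exists (fun=> 0); first by split=> // A B; rewrite ltxx.
  move=> i; rewrite /weight_at big1//; apply/eqP; rewrite eq_le x0/= leNgt.
  by rewrite -in_support S0 finset.inE.
have [i0 i0S] := set0Pn _ Sn0.
have [m mS mmin] : exists2 m, m \in Defs.support x &
    forall i, i \in Defs.support x -> x m <= x i.
  case: (arg_minP x i0S) => m mS mmin; exists m => //.
pose x' i := if i \in Defs.support x then x i - x m else 0.
have x'0 i : 0 <= x' i by rewrite /x'; case: ifP => // /mmin; rewrite subr_ge0.
have sx' i : 0 < x' i -> i \in Defs.support x /\ i != m.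
  rewrite /x'; case: ifP => [iS xi|]; last by rewrite ltxx.
  by split=> //; apply: contraTneq xi => ->; rewrite subrr ltxx.
have [|w [w0 wc] wx'] := IH x' _ x'0.
  apply: leq_trans xn; apply: proper_card; apply/fintype.properP; split.
    by apply/fintype.subsetP => i; rewrite finset.in_set => /sx'[].
  by exists m => //; rewrite finset.in_set; apply/negP => /sx'[_]; rewrite eqxx.
pose S : nset := exist _ (Defs.support x) Sn0.
have wS A : 0 < w A -> val A \subset val S.
  move=> wA; apply/fintype.subsetP => i iA.
  have /sx'[//] : 0 < x' i.
  by rewrite -wx'; apply/(weight_at_gt0 _ (conj w0 wc)); exists A.
exists (fun A => w A + if A == S then x m else 0).
  split=> [A|A B]; first by rewrite addr_ge0//; case: ifP.
  have [->|_] := eqVneq A S; have [->|_] := eqVneq B S; rewrite ?addr0.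
  - by rewrite fintype.subxx.
  - by move=> _ /wS ->; rewrite orbT.
  - by move=> /wS ->.
  - exact: wc.
move=> i; rewrite /weight_at big_split/= -/(weight_at w i) wx' -big_mkcondr/= /x'.
case: ifPn => iS.
  by rewrite (big_pred1 S) ?subrK// => A; apply: andb_idl => /eqP ->.
rewrite add0r big1 => [|A /andP[iA /eqP AS]]; last first.
  by rewrite AS (negbTE iS) in iA.
apply/eqP; rewrite eq_le x0/= leNgt; move: iS; rewrite finset.in_set//.
Qed.
End ChainWeights.

(** * Cusp profiles *)

Section Gauge.
Context (R : realType).

(** The lower bounds for the width of a neighborhood, as a function of the
distance to the lower strata. *)
Definition gauge (h : R -> R) :=
  [/\ continuous h, {homo h : s t / s <= t}, forall t, 0 <= h t <= 1 &
      forall t, 0 < t -> 0 < h t].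

Lemma gauge_prod (I : finType) (h : I -> R -> R) : (forall i, gauge (h i)) ->
  gauge (fun t => \prod_i h i t) /\ forall i t, \prod_i h i t <= h i t.
Proof.
move=> gh.
have h01 i t : 0 <= h i t <= 1 by have [] := gh i.
split; last first.
  move=> i t; rewrite (bigD1 i)//= ler_piMr//; first by have /andP[] := h01 i t.
  by apply: prodr_ile1 => j _; exact: h01.
split=> [|s t st|t|t t0].
- by apply: continuous_big => [|i _]; [exact: mul_continuous|have [] := gh i].
- apply: ler_prod => i _; have /andP[-> _] := h01 i s; have [_ hm _ _] := gh i.
  exact: hm.
- rewrite prodr_ge0/=; last by move=> i _; have /andP[] := h01 i t.
  by apply: prodr_ile1 => j _; exact: h01.
- by apply: prodr_gt0 => i _; have [_ _ _ +] := gh i; exact.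
Qed.

(** For points [y] to be avoided, [a y] is the distance to the closure of a
stratum and [b y] measures how far [y] is from the lower strata. The infimum
of 1 and of all [a y + max 0 (t - b y)] with [y] in [B] is 1-Lipschitz and
nondecreasing in [t], and it is at most [a y] for [t = b y]; compactness makes
it positive for [t > 0]. *)
Lemma exists_gauge_minorant (T : topologicalType) (B : set T) (a b : T -> R) :
  compact B -> continuous a -> continuous b -> (forall y, 0 <= a y) ->
  (forall y, B y -> a y = 0 -> b y <= 0) ->
  exists2 h, gauge h & forall y, B y -> h (b y) <= a y.
Proof.
move=> cB ca cb a0 ab.
pose E t : set R := [set r | r = 1 \/
  exists2 y, B y & r = a y + Num.max 0 (t - b y)].
pose h t := inf (E t).
have E0 t : E t !=set0 by exists 1; left.
have lbE0 t : lbound (E t) 0.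
  by move=> _ [->//|[y _ ->]]; rewrite addr_ge0// le_max lexx.
have hlb t : has_lbound (E t) by exists 0.
have hlip s t : h t <= h s + Num.max 0 (t - s).
  rewrite -lerBlDr; apply: lb_le_inf => // _ [->|[y By ->]].
    rewrite lerBlDr (@le_trans _ _ 1)//; first by apply: ge_inf => //; left.
    by rewrite lerDl le_max lexx.
  rewrite lerBlDr (@le_trans _ _ (a y + Num.max 0 (t - b y)))//.
    by apply: ge_inf => //; right; exists y.
  rewrite -addrA lerD2l ge_max addr_ge0 ?le_max ?lexx//=.
  by rewrite -(subrKA s) addrC lerD// le_max lexx orbT.
exists h; first split.
- move=> t; apply/cvgrPdist_le => e e0; near=> s.
  have st : `|t - s| <= e by near: s; apply: cvgr_dist_le.
  have mx (u v : R) : `|u - v| <= e -> Num.max 0 (u - v) <= e.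
    by move=> uv; rewrite ge_max (ltW e0)/= (le_trans (ler_norm _)).
  rewrite ler_distlC; apply/andP; split.
    by rewrite lerBlDr (le_trans (hlip s t))// lerD2l mx.
  by rewrite (le_trans (hlip t s))// lerD2l mx// distrC.
- move=> s t st; rewrite (le_trans (hlip t s))// max_l ?addr0// subr_le0//.
- move=> t; rewrite lb_le_inf//= ge_inf//; by left.
- move=> t t0.
  have [||c c0 cE] := @compact_pos_lower_bound R T B
    (fun y => a y + Num.max 0 (t - b y)) cB.
  + move=> y; apply: cvgD; first exact: ca.
    apply: (@max_fun_continuous _ T R (fun=> 0) (fun y => t - b y)).
      exact: cst_continuous.
    by move=> z; apply: cvgB; [exact: cvg_cst|exact: cb].
  + move=> y By; have [ay0|ay0] := ltP 0 (a y).
      by rewrite ltr_pwDl// le_max lexx.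
    have {}ay0 : a y = 0 by apply/eqP; rewrite eq_le ay0 a0.
    by rewrite ay0 add0r lt_max subr_gt0 (le_lt_trans (ab y By ay0))// orbT.
  apply: (@lt_le_trans _ _ (Num.min c 1)); first by rewrite lt_min c0/=.
  apply: lb_le_inf => // _ [->|[y By ->]]; first by rewrite ge_min lexx orbT.
  by rewrite ge_min cE.
- move=> y By; apply: (@le_trans _ _ (a y + Num.max 0 (b y - b y))).
    by apply: ge_inf => //; right; exists y.
  by rewrite subrr maxxx addr0.
Unshelve. all: by end_near. Qed.

Section Shrink.
Variables (h : R -> R) (N : nat).
Hypothesis gh : gauge h.

(** The factor [t] makes [shrink t / t] nondecreasing, so that points of the cusp
bounded by [shrink] stay in it when they are scaled up to total weight 1
([shrink_sublinear]); it also makes [shrink] strictly increasing on [t >= 0].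
The denominator is chosen so that [N] coordinates of size at most [shrink t]
add up to less than [t * h t] for [t > 0]. *)
Definition shrink (t : R) : R := t * h t / N.+1%:R.

Let N0 : 0 < N.+1%:R^-1 :> R. Proof. by rewrite invr_gt0 ltr0n. Qed.
Let N1 : N.+1%:R^-1 <= 1 :> R.
Proof. by rewrite invf_le1 ?ltr0n// ler1n. Qed.
Let h0 t : 0 <= h t. Proof. by have [_ _ /(_ t)/andP[]] := gh. Qed.
Let h1 t : h t <= 1. Proof. by have [_ _ /(_ t)/andP[]] := gh. Qed.
Let hm s t : s <= t -> h s <= h t. Proof. by have [_ + _ _] := gh; exact. Qed.

Lemma shrink_continuous : continuous shrink.
Proof.
move=> t; apply: cvgM; last exact: cvg_cst.
by apply: cvgM; [exact: cvg_id|have [+ _ _ _] := gh; exact].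
Qed.

Lemma shrink0 : shrink 0 = 0. Proof. by rewrite /shrink !mul0r. Qed.

Lemma shrink_ge0 t : 0 <= t -> 0 <= shrink t.
Proof. by move=> t0; rewrite !mulr_ge0// ltW. Qed.

Lemma shrink_le t : 0 <= t -> shrink t <= t.
Proof.
move=> t0; rewrite /shrink -mulrA.
have : h t / N.+1%:R <= 1 by rewrite mulr_ile1// ltW.
exact: ler_piMr.
Qed.

Lemma shrink_le_inv t : 0 <= t <= 1 -> shrink t <= N.+1%:R^-1.
Proof.
move=> /andP[t0 t1]; have : t * h t <= 1 by rewrite mulr_ile1.
by apply: ler_piMl; exact: ltW.
Qed.

Lemma shrink_mono s t : 0 <= s -> s < t -> shrink s < shrink t.
Proof.
move=> s0 st; rewrite ltr_pM2r// (@le_lt_trans _ _ (s * h t))//.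
  by rewrite ler_wpM2l// hm// ltW.
rewrite ltr_pM2r//; have [_ _ _] := gh; apply; exact: le_lt_trans st.
Qed.

Lemma shrink_sublinear c t : 0 <= c <= 1 -> 0 <= t ->
  shrink (c * t) <= c * shrink t.
Proof.
move=> /andP[c0 c1] t0; rewrite /shrink !mulrA ler_wpM2r//; first exact: ltW.
by rewrite ler_wpM2l ?mulr_ge0// hm// ler_piMl.
Qed.

Lemma iter_shrink_continuous k : continuous (iter k shrink).
Proof.
elim: k => [|k IH] t /=; first exact: cvg_id.
apply: (@continuous_comp _ _ _ (iter k shrink)); first exact: IH.
exact: shrink_continuous.
Qed.

Lemma iter_shrink0 k : iter k shrink 0 = 0.
Proof. by elim: k => //= k ->; exact: shrink0. Qed.

Lemma iter_shrink_ge0 k t : 0 <= t -> 0 <= iter k shrink t.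
Proof. by move=> t0; elim: k => //= k; exact: shrink_ge0. Qed.

Lemma iter_shrink_mono k s t : 0 <= s -> s < t ->
  iter k shrink s < iter k shrink t.
Proof.
by move=> s0 st; elim: k => //= k; apply: shrink_mono; exact: iter_shrink_ge0.
Qed.

Lemma iter_shrink_homo k s t : 0 <= s -> s <= t ->
  iter k shrink s <= iter k shrink t.
Proof.
move=> s0; rewrite le_eqVlt => /orP[/eqP->//|st].
by apply/ltW; exact: iter_shrink_mono.
Qed.

Lemma iter_shrink_le k l t : 0 <= t -> (l <= k)%N ->
  iter k shrink t <= iter l shrink t.
Proof.
move=> t0 /subnK <-; rewrite iterD; elim: (k - l)%N => //= m.
by apply: le_trans; rewrite shrink_le// -iterD iter_shrink_ge0.
Qed.
End Shrink.
End Gauge.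

(** * Subdivisions of one simplex *)

Section Subdivide.
Context (R : realType) (d : Order.disp_t) (P : porderType d) (J : flag P).
Local Notation idx := 'I_(flag_dim J).+1.
Local Notation sdJ := (realization R (sd J)).
Local Notation simJ := (realization R (simplex J)).

Definition sd_weight (w : sdJ) : subflag J -> R :=
  fun A => coord (A : vert (sd J)) w.
Definition bary (i : idx) (y : simJ) : R := coord (i : vert (simplex J)) y.

Lemma in_supp_sd (w : sdJ) (A : subflag J) :
  (A \in (supp w : {set subflag J})) = (0 < sd_weight w A).
Proof. exact: in_support. Qed.

Lemma in_supp_simplex (y : simJ) (i : idx) :
  (i \in (supp y : {set idx})) = (0 < bary i y).
Proof. exact: in_support. Qed.

Lemma simplex_ext (y y' : simJ) : bary^~ y =1 bary^~ y' -> y = y'.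
Proof. exact: (@realization_ext _ _ _ (simplex J)). Qed.

(** What [barycentric_subdivision] asks of a single cell. *)
Record is_subdivision (psi : sdJ -> simJ) : Prop := IsSubdivision {
  is_subdivision_strat : stratum_preserving psi;
  is_subdivision_homeo : homeomorphism psi;
  is_subdivision_face : forall A : subflag J,
    psi @` subrealization (sd_simplex_face (val A)) `<=`
    subrealization (simplex_face (val A)) }.

Lemma simplex_realization_set (y : idx -> R) : (forall i, 0 <= y i) ->
  \sum_i y i = 1 -> realization_set (faces (simplex J)) y.
Proof. by move=> y0 y1; split=> //; rewrite finset.in_setT. Qed.

Definition simplex_point (y : idx -> R) (y0 : forall i, 0 <= y i)
    (y1 : \sum_i y i = 1) : simJ :=
  exist _ y (mem_set (simplex_realization_set y0 y1)).

Lemma sd_chain_weight (w : sdJ) : chain_weight (sd_weight w).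
Proof.
split=> [A|A B wA wB]; first exact: coord_ge0.
have := coord_support w; rewrite finset.in_set => /forall_inP/(_ A).
by rewrite in_supp_sd => /(_ wA)/forall_inP/(_ B); rewrite in_supp_sd; exact.
Qed.

Lemma sd_realization_set (w : subflag J -> R) : chain_weight w ->
  \sum_A w A = 1 -> realization_set (faces (sd J)) w.
Proof.
move=> [w0 wc] w1; split=> //; rewrite finset.in_set.
by apply/forall_inP => A; rewrite in_support => wA; apply/forall_inP => B;
  rewrite in_support => wB; exact: wc.
Qed.

(** The heights of a point of |sd| are its coordinates in the model
[{x >= 0 | max x = 1}] of the subdivided simplex. *)
Definition height (w : sdJ) (i : idx) : R :=
  weight_at (sd_weight w) i.

Lemma height_ge0 w i : 0 <= height w i.
Proof. exact: weight_at_ge0 (sd_chain_weight w). Qed.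

Lemma height_le1 w i : height w i <= 1.
Proof. by rewrite -(coord_sum1 w); exact: weight_at_le (sd_chain_weight w). Qed.

Lemma exists_height1 w : exists i, height w i = 1.
Proof.
have [|i iw] := weight_at_eq_sum (sd_chain_weight w).
  by have [A] := set0Pn _ (supp_neq0 w); rewrite in_supp_sd; exists A.
by exists i; rewrite /height iw; exact: (coord_sum1 w).
Qed.

Lemma height_inj w w' : height w =1 height w' -> w = w'.
Proof.
move=> ww'; apply: realization_ext.
by apply: (weight_at_inj _ _ ww'); exact: sd_chain_weight.
Qed.

Lemma height_surj (x : idx -> R) : (forall i, 0 <= x i <= 1) ->
  (exists i, x i = 1) -> exists w, height w =1 x.
Proof.
move=> x01 [i1 xi1].
have [w cw wx] : exists2 w : subflag J -> R, chain_weight w & weight_at w =1 x.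
  by apply: weight_at_surj => i; have /andP[] := x01 i.
have w1 : \sum_A w A = 1.
  apply/eqP; rewrite eq_le -{2}xi1 -wx weight_at_le// andbT.
  have [|i <-] := weight_at_eq_sum cw; last by rewrite wx; have /andP[] := x01 i.
  have /(weight_at_gt0 _ cw)[A wA _] : 0 < weight_at w i1 by rewrite wx xi1.
  by exists A.
by exists (exist _ w (mem_set (sd_realization_set cw w1))).
Qed.

Lemma height_gt0 w i :
  0 < height w i <-> exists2 A : subflag J, A \in supp w & i \in val A.
Proof.
rewrite /height weight_at_gt0; last exact: sd_chain_weight.
by split=> -[A wA iA]; exists A; rewrite ?in_supp_sd// -in_supp_sd.
Qed.

Lemma height_continuous i : continuous (height^~ i).
Proof. by apply: continuous_sum => A; exact: coord_continuous. Qed.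

Section Map.
Variable h : R -> R.
Hypothesis gh : gauge h.
Local Notation eps := (shrink h (flag_dim J).+1).

(** Iterating [i.+1] times, and not [i] times, makes all damped heights at most
[eps 1], hence their sum at most 1 ([damped_sum_le1]). *)
Definition damped (w : sdJ) (i : idx) : R := iter i.+1 eps (height w i).
Definition damped_sum (w : sdJ) : R := \sum_i damped w i.

Lemma damped_ge0 w i : 0 <= damped w i.
Proof. exact: (iter_shrink_ge0 _ gh _ (height_ge0 w i)). Qed.

Lemma damped_gt0 w i : (0 < damped w i) = (0 < height w i).
Proof.
apply/idP/idP => [|h0]; last first.
  rewrite -(iter_shrink0 h (flag_dim J).+1 i.+1).
  exact: (iter_shrink_mono _ gh).
apply: contraTT; rewrite -!leNgt /damped => h0.
have -> : height w i = 0 by apply/eqP; rewrite eq_le h0 height_ge0.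
by rewrite iter_shrink0.
Qed.

Lemma damped_sum_gt0 w : 0 < damped_sum w.
Proof.
have [i hi] := exists_height1 w.
rewrite /damped_sum (bigD1 i)//= ltr_pwDl ?damped_gt0 ?hi//.
by apply: sumr_ge0 => j _; exact: damped_ge0.
Qed.

(** Dividing by the sum thus never shrinks a coordinate, which is the direction in
which [shrink_sublinear] lets inequalities [y_i <= eps y_j] persist. *)
Lemma damped_sum_le1 w : damped_sum w <= 1.
Proof.
apply: (@le_trans _ _ (\sum_(i < (flag_dim J).+1) (flag_dim J).+2%:R^-1)).
  apply: ler_sum => i _; apply: le_trans (shrink_le_inv _ gh (t := height w i) _).
    exact: (iter_shrink_le (k := i.+1) (l := 1%N) _ gh (height_ge0 w i) isT).
  by rewrite height_ge0 height_le1.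
rewrite sumr_const card_ord -[leLHS]mulr_natl.
by rewrite ler_pdivrMr ?ltr0n// mul1r ler_nat.
Qed.

Lemma sum_normalized w : \sum_i damped w i / damped_sum w = 1.
Proof. by rewrite -mulr_suml divff// gt_eqF// damped_sum_gt0. Qed.

Lemma normalized_ge0 w i : 0 <= damped w i / damped_sum w.
Proof. by rewrite divr_ge0 ?damped_ge0// ltW// damped_sum_gt0. Qed.

Definition damped_map (w : sdJ) : simJ :=
  simplex_point (normalized_ge0 w) (sum_normalized w).

Lemma damped_mapE w i : bary i (damped_map w) = damped w i / damped_sum w.
Proof. by []. Qed.

Lemma damped_map_gt0 w i : (0 < bary i (damped_map w)) = (0 < height w i).
Proof.
by rewrite damped_mapE pmulr_lgt0 ?invr_gt0 ?damped_sum_gt0// damped_gt0.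
Qed.

Lemma damped_continuous i : continuous (damped^~ i).
Proof.
move=> w; apply: (@continuous_comp _ _ _ (height^~ i) (iter i.+1 eps)).
  exact: height_continuous.
exact: iter_shrink_continuous.
Qed.

Lemma damped_map_continuous : continuous damped_map.
Proof.
apply: continuous_coord => i; apply: (@continuous_ratio R sdJ (damped^~ i)).
- exact: damped_continuous.
- exact: (continuous_sum damped_continuous).
- by move=> w; rewrite gt_eqF// damped_sum_gt0.
Qed.

Lemma iter_shrink_inj k s t : 0 <= s -> 0 <= t ->
  iter k eps s = iter k eps t -> s = t.
Proof.
move=> s0 t0 st; apply/eqP; rewrite eq_le !leNgt; apply/andP; split; apply/negP.
  by move=> /(iter_shrink_mono (flag_dim J).+1 gh k t0); rewrite st ltxx.
by move=> /(iter_shrink_mono (flag_dim J).+1 gh k s0); rewrite st ltxx.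
Qed.

(** Where the height of [w'] is 1, the damped height of [w'] is the largest
possible. Comparing there with the normalized values of [w] bounds the
normalizing factor of [w] by that of [w']; by symmetry they agree, and each
coordinate can be inverted. *)
Lemma damped_map_inj : injective damped_map.
Proof.
have le_sum w w' : damped_map w = damped_map w' -> damped_sum w <= damped_sum w'.
  move=> ww'; have [i hi] := exists_height1 w'.
  have zz' : damped w i / damped_sum w = damped w' i / damped_sum w'.
    by rewrite -!damped_mapE ww'.
  have zle : damped w i <= damped w' i.
    rewrite /damped hi; have [->//|] := eqVneq (height w i) 1 => hn1.
    apply/ltW/(iter_shrink_mono _ gh); rewrite ?height_ge0// lt_neqAle hn1.
    exact: height_le1.
  have z0 : 0 < damped w' i by rewrite damped_gt0 hi.
  move: zz' => /eqP; rewrite eqr_div ?lt0r_neq0 ?damped_sum_gt0// => /eqP zz'.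
  by rewrite -(ler_pM2l z0) -zz' ler_wpM2r// ltW// damped_sum_gt0.
move=> w w' ww'.
have cc' : damped_sum w = damped_sum w' by apply/eqP; rewrite eq_le !le_sum.
apply: height_inj => i; apply: (@iter_shrink_inj i.+1); rewrite ?height_ge0//.
have : damped w i / damped_sum w = damped w' i / damped_sum w'.
  by rewrite -!damped_mapE ww'.
by rewrite cc' => /(divIf _); apply; rewrite gt_eqF// damped_sum_gt0.
Qed.

(** A point [y] must be rescaled to [s * y] before undoing the damping. The right
[s] is the largest one for which no height exceeds 1: the bound is then
attained at some vertex [m]. *)
Lemma damped_map_surj y : exists w, damped_map w = y.
Proof.
have [i0] := set0Pn _ (supp_neq0 y); rewrite in_supp_simplex => yi0.
have phi1 (i : idx) : 0 < iter i.+1 eps 1.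
  rewrite -(iter_shrink0 h (flag_dim J).+1 i.+1).
  exact: (iter_shrink_mono _ gh).
case: (@arg_minP _ _ _ i0 (fun i => 0 < bary i y)
  (fun i : idx => iter i.+1 eps 1 / bary i y) yi0) => m ym mmin.
set s := iter m.+1 eps 1 / bary m y in mmin.
have s0 : 0 < s by rewrite divr_gt0.
have sy i : 0 <= s * bary i y <= iter i.+1 eps 1.
  rewrite mulr_ge0 ?coord_ge0 ?(ltW s0)//=.
  have [yi|yi] := ltP 0 (bary i y); first by rewrite -ler_pdivlMr// mmin.
  apply: le_trans (ltW (phi1 i)); apply: mulr_ge0_le0 => //; exact: ltW.
have /choice[x xP] (i : idx) :
    exists x, 0 <= x <= 1 /\ iter i.+1 eps x = s * bary i y.
  have [|||x x01 xE] := @IVT R (iter i.+1 eps) 0 1 (s * bary i y).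
  - exact: ler01.
  - by apply: continuous_subspaceT; exact: iter_shrink_continuous.
  - by rewrite iter_shrink0 min_l ?max_r ?(ltW (phi1 i))//.
  - by exists x; split=> //; move: x01; rewrite in_itv.
have xm : x m = 1.
  have [/andP[x0 x1] xE] := xP m.
  apply: (iter_shrink_inj (k := m.+1)) => //.
  by rewrite xE /s divfK// gt_eqF.
have [w wx] := height_surj (fun i => (xP i).1) (ex_intro _ m xm).
have dw i : damped w i = s * bary i y by rewrite /damped wx (xP i).2.
exists w; apply: simplex_ext => i.
rewrite damped_mapE dw /damped_sum (eq_bigr _ (fun i _ => dw i)) -mulr_sumr.
by rewrite (coord_sum1 y) mulr1 mulrAC divff ?mul1r// gt_eqF.
Qed.

(** The vertices with nonzero coordinate in the image are those contained in
some subflag of positive weight, so both points have the same largest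
label. *)
Lemma damped_map_strat : stratum_preserving damped_map.
Proof.
split=> [|w]; first exact: damped_map_continuous.
apply: (greatest_unique (strat_greatest _)).
have [[A Aw Ap] pm] := strat_greatest w; split.
  have [[i iA iE] _] := subflag_max_greatest A.
  exists i; last by rewrite /= iE.
  by rewrite in_supp_simplex damped_map_gt0; apply/height_gt0; exists A.
move=> i; rewrite in_supp_simplex damped_map_gt0 => /height_gt0[B Bw iB].
apply: le_trans (pm B Bw); exact: (subflag_max_greatest B).2.
Qed.

Lemma damped_map_subdivision : is_subdivision damped_map.
Proof.
split.
- exact: damped_map_strat.
- apply: compact_hausdorff_homeo.
  + exact: realization_compact.
  + exact: realization_hausdorff.
  + exact: damped_map_continuous.
  + exact: damped_map_inj.
  + exact: damped_map_surj.
- move=> A _ [w + <-].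
  rewrite /subrealization /= finset.in_set => /andP[_ /fintype.subsetP wA].
  rewrite finset.in_set; apply/fintype.subsetP => i.
  rewrite in_supp_simplex damped_map_gt0 => /height_gt0[B /wA].
  by rewrite finset.in_set => /fintype.subsetP; exact.
Qed.
End Map.
End Subdivide.

Section Thin.
Context (R : realType) (d : Order.disp_t) (P : porderType d) (J : flag P).
Local Notation idx := 'I_(flag_dim J).+1.
Local Notation sdJ := (realization R (sd J)).
Local Notation simJ := (realization R (simplex J)).
Local Notation N := (flag_dim J).+1.

Lemma in_S_simplex (w : sdJ) p (A : subflag J) :
    subrealization (S_simplex J p) w -> A \in (supp w : {set subflag J}) ->
  (exists2 i, i \in val A & J i = p) \/ (forall i, i \in val A -> (J i < p)%O).
Proof.
rewrite /subrealization /= finset.in_set => /andP[_ /fintype.subsetP wS] /wS.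
rewrite finset.in_set => /orP[/exists_inP[i iA /eqP Jp]|/forall_inP Ap].
  by left; exists i.
by right.
Qed.

(** The smallest subflag of positive weight that contains [i] has an entry above
[p], so by definition of S(p) it contains an entry equal to [p]. *)
Lemma height_le_of_S_simplex (w : sdJ) p i : subrealization (S_simplex J p) w ->
    (p < J i)%O -> 0 < height w i ->
  exists2 j, J j = p & height w i <= height w j.
Proof.
move=> Sw pi hi.
have [A [wA iA Aj]] := weight_at_dominated (sd_chain_weight w) hi.
have [|[j jA Jj]|/(_ i iA) ip] := in_S_simplex Sw (A := A).
- by rewrite in_supp_sd.
- by exists j => //; exact: Aj.
- by have := lt_trans pi ip; rewrite ltxx.
Qed.

(** One [j] serves all [i]: the highest vertex with label [p]. As labels are
nondecreasing, [j < i], so that the height of [i] is damped at least once more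
than the height of [j]. *)
Lemma damped_map_thin (h : R -> R) (gh : gauge h) (w : sdJ) p :
    subrealization (S_simplex J p) w ->
  stratum_le simJ p (damped_map gh w) \/
  exists j, [/\ J j = p, 0 < bary j (damped_map gh w) & forall i, (p < J i)%O ->
    bary i (damped_map gh w) <= shrink h N (bary j (damped_map gh w))].
Proof.
move=> Sw.
have [[j0 Jj0 hj0]|none] :=
  pselect (exists2 j, J j = p & 0 < height w j); last first.
  left; have [[i + iE] _] := strat_greatest (damped_map gh w).
  rewrite in_supp_simplex damped_map_gt0 => /[dup] hi /height_gt0[A Aw iA].
  rewrite /stratum_le /mkset -iE.
  have [[j jA Jj]|/(_ i iA)/ltW//] := in_S_simplex Sw Aw.
  by exfalso; apply: none; exists j => //; apply/height_gt0; exists A.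
right.
have j0P : J j0 == p by rewrite Jj0.
case: (@arg_maxP _ _ _ j0 (fun j => J j == p) (height w) j0P) => j /eqP Jj jmax.
have hj : 0 < height w j by apply: lt_le_trans hj0 _; exact: jmax.
exists j; split=> //; first by rewrite damped_map_gt0.
move=> i pi.
have hij : height w i <= height w j.
  have [hi|hi] := ltP 0 (height w i); last by rewrite (le_trans hi)// ltW.
  have [k Jk hk] := height_le_of_S_simplex Sw pi hi.
  by apply: le_trans hk _; apply: jmax; rewrite Jk.
have ji : (j < i)%N.
  rewrite ltnNge; apply/negP => /(@flag_nondecreasing _ _ J) ij.
  by move: pi; rewrite -Jj => /lt_le_trans/(_ ij); rewrite ltxx.
have c0 := damped_sum_gt0 gh w.
rewrite !damped_mapE ler_pdivrMr// mulrC.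
apply: le_trans (shrink_sublinear _ gh _ _); first last.
- by rewrite divr_ge0// ?damped_ge0// ltW.
- by rewrite (ltW c0) damped_sum_le1.
rewrite mulrC divfK ?gt_eqF//.
apply: (@le_trans _ _ (iter i.+1 (shrink h N) (height w j))).
  by apply: (iter_shrink_homo _ gh) => //; exact: height_ge0.
by apply: (iter_shrink_le (l := j.+2) _ gh); rewrite ?height_ge0.
Qed.

Lemma bary_continuous i : continuous (@bary R d P J i).
Proof. exact: coord_continuous. Qed.

(** For a vertex [j] with label [p], the points outside the interior of [W p] have
[bary j y = 0] as soon as their coordinates above [p] vanish: otherwise they
would lie in the stratum of [p]. This gives a gauge for each [j], and their
product bounds the cusps. *)
Theorem exists_subdivision_into (W : P -> set simJ) :
    (forall p, stratum simJ p `<=` (W p)°) ->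
    (forall p, stratum_le simJ p `<=` W p) ->
  exists2 psi : sdJ -> simJ, is_subdivision psi &
    forall p, psi @` subrealization (S_simplex J p) `<=` W p.
Proof.
move=> Wn Wle.
pose above p (y : simJ) := \sum_(i : idx | (p < J i)%O) bary i y.
have /choice[h /all_and2 [gh hP]] (j : idx) : exists h : R -> R, gauge h /\
    forall y, (~` (W (J j))°) y -> h (bary j y) <= above (J j) y.
  have [|||||h gh hP] := @exists_gauge_minorant R simJ (~` (W (J j))°)
    (above (J j)) (bary j).
  - apply: (subclosed_compact _ (@realization_compact R _ _ (simplex J))) => //.
    by apply: open_closedC; exact: open_interior.
  - by apply: continuous_sum => i; exact: bary_continuous.
  - exact: bary_continuous.
  - by move=> y; apply: sumr_ge0 => i _; exact: coord_ge0.
  - move=> y nW a0; rewrite leNgt; apply/negP => yj; apply: nW; apply: Wn.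
    apply: (greatest_unique (strat_greatest y)); split.
      by exists j => //; rewrite in_supp_simplex.
    move=> i; rewrite in_supp_simplex => yi.
    have /orP[//|] := flag_chain i j; rewrite le_eqVlt => /orP[/eqP ->//|ji].
    move: a0; rewrite /above (bigD1 i)//= => /eqP.
    rewrite paddr_eq0; first by rewrite gt_eqF.
      exact: ltW.
    by apply: sumr_ge0 => k _; exact: coord_ge0.
  - by exists h.
have [gph hle] := gauge_prod gh.
set H := fun t => _ in gph.
exists (damped_map gph); first exact: damped_map_subdivision.
move=> p _ [w Sw <-].
have [/Wle//|[j [Jj yj ythin]]] := damped_map_thin gph Sw.
set y := damped_map gph w in yj ythin *.
apply: contrapT => nW.
have := hP j y; rewrite Jj => /(_ (contra_not (@interior_subset _ _ _) nW)).
apply/negP; rewrite -ltNge.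
apply: (@lt_le_trans _ _ (H (bary j y))); last exact: hle.
apply: (@le_lt_trans _ _ (\sum_(i : idx) shrink H N (bary j y))).
  rewrite /above big_mkcond/=; apply: ler_sum => i _; case: ifPn => [/ythin//|_].
  by apply: (shrink_ge0 _ gph); exact: ltW.
have [_ _ H01 Hpos] := gph; have y1 : bary j y <= 1 by exact: coord_le1.
have Hy := Hpos _ yj.
(* [N] coordinates, each at most [y_j * H y_j / N.+1], sum to less than
   [H y_j]. *)
rewrite sumr_const card_ord -[ltLHS]mulr_natl /shrink mulrA.
rewrite ltr_pdivrMr ?ltr0n// [ltRHS]mulrC.
apply: (@le_lt_trans _ _ (N%:R * H (bary j y))); last first.
  by rewrite ltr_pM2r// ltr_nat.
by apply: ler_wpM2l => //; rewrite ler_piMl// ltW.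
Qed.
End Thin.

(** * Standard neighborhoods in one simplex *)

Section SNeighborhood.
Context (R : realType) (d : Order.disp_t) (P : porderType d) (J : flag P).
Local Notation sdJ := (realization R (sd J)).
Local Notation simJ := (realization R (simplex J)).

Lemma S_vertex_of_max_le (p : P) (B : subflag J) : (subflag_max B <= p)%O ->
  [exists i in val B, J i == p] || [forall i in val B, (J i < p)%O].
Proof.
move=> Bp; have [_ mB] := subflag_max_greatest B.
apply/orP; have [?|/exists_inPn nB] := boolP [exists i in val B, J i == p].
  by left.
right; apply/forall_inP => i iB.
by rewrite lt_neqAle nB//= (le_trans (mB i iB)).
Qed.

Lemma in_S_realization p (w : sdJ) :
  (forall B : subflag J, 0 < sd_weight w B ->
    [exists i in val B, J i == p] || [forall i in val B, (J i < p)%O]) ->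
  subrealization (S_simplex J p) w.
Proof.
move=> wS; rewrite /subrealization/= finset.in_set; apply/andP; split.
  exact: coord_support.
apply/fintype.subsetP => B; rewrite in_supp_sd => /wS wB.
by rewrite finset.in_set.
Qed.

(** If [w] gives positive weight to a subflag [A] with maximum [p], then all
subflags of its chain are vertices of S(p): those containing [A] contain the
entry [p], and those contained in [A] have maximum at most [p]. Positivity of
a weight is an open condition. *)
Lemma S_realization_nbhd p :
  stratum sdJ p `<=` (@subrealization R _ _ (sd J) (S_simplex J p))°.
Proof.
pose O := \bigcup_(A in [set A : subflag J | subflag_max A = p])
  [set w : sdJ | 0 < sd_weight w A].
have oO : open O.
  apply: bigcup_open => A _.
  have cA : continuous (fun w : sdJ => sd_weight w A).
    exact: (@coord_continuous R _ _ (sd J)).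
  by move/continuousP : cA => /(_ [set r | 0 < r]); apply; exact: open_gt.
have OS : O `<=` @subrealization R _ _ (sd J) (S_simplex J p).
  move=> w [A /= Ap wA]; apply: in_S_realization => B wB.
  have [sAB|sBA] := orP ((sd_chain_weight w).2 A B wA wB).
    have [[i iA Ji] _] := subflag_max_greatest A.
    apply/orP; left; apply/exists_inP; exists i; last by rewrite Ji Ap.
    exact: (fintype.subsetP sAB).
  by apply: S_vertex_of_max_le; rewrite -Ap subflag_max_le.
rewrite open_subsetE// in OS; move=> w wp; apply: OS.
have [[A wA Ap] _] := strat_greatest w.
by exists A; rewrite /mkset -?in_supp_sd// -wp -Ap.
Qed.

Lemma stratum_le_S_realization p :
  stratum_le sdJ p `<=` @subrealization R _ _ (sd J) (S_simplex J p).
Proof.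
move=> w wp; apply: in_S_realization => B wB; apply: S_vertex_of_max_le.
have [_ wm] := strat_greatest w; apply: le_trans wp; apply: wm.
by rewrite in_supp_sd.
Qed.

Variables (psi : sdJ -> simJ) (psiP : is_subdivision psi).

Lemma subdivision_S_nbhd p :
  stratum simJ p `<=` (psi @` subrealization (S_simplex J p))°.
Proof.
have [[_ ps] [_ [g [cg gK Kg]]] _] := psiP.
move=> y yp.
have -> : psi @` subrealization (S_simplex J p) =
    g @^-1` subrealization (S_simplex J p).
  apply/seteqP; split=> [_ [w Sw <-]|z Sz] /=; first by rewrite gK.
  by exists (g z).
apply: cg; apply: S_realization_nbhd; rewrite /stratum /mkset.
by rewrite -yp -{2}(Kg y) ps.
Qed.

Lemma stratum_le_subdivision_S p :
  stratum_le simJ p `<=` psi @` subrealization (S_simplex J p).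
Proof.
have [[_ ps] [_ [g [_ _ Kg]]] _] := psiP.
move=> y yp; exists (g y) => //; apply: stratum_le_S_realization.
by rewrite /stratum_le /mkset -ps Kg.
Qed.

(** The largest subflag of the chain is proper, and the subdivision respects the
face that it spans. *)
Lemma subdivision_boundary p (w : sdJ) : subrealization (S_boundary J p) w ->
  subrealization (simplex_boundary J) (psi w).
Proof.
rewrite /subrealization /= finset.in_setI => /andP[_].
rewrite finset.in_set => /andP[wf /forall_inP wT].
have [A0 A0w] := set0Pn _ (supp_neq0 w).
case: (@arg_maxnP _ A0 (fun A => A \in supp w)
  (fun A : subflag J => #|val A|) A0w) => A Aw Amax.
have cw := (sd_chain_weight w).2.
have BA (B : subflag J) : B \in (supp w : {set subflag J}) -> val B \subset val A.
  move=> Bw; have := cw A B; rewrite -!in_supp_sd => /(_ Aw Bw)/orP[sAB|//].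
  have /eqP <- : val A == val B by rewrite finset.eqEcard sAB; exact: Amax.
  exact: fintype.subxx.
have iw : (psi @` subrealization (sd_simplex_face (val A))) (psi w).
  exists w => //; rewrite /subrealization/= finset.in_set wf.
  apply/fintype.subsetP => B Bw.
  by rewrite finset.in_set; exact: BA.
have := is_subdivision_face psiP iw.
rewrite /subrealization/= !finset.in_set => sA.
apply: contra_neq (wT A Aw) => sT.
by apply/eqP; rewrite -finset.subTset -sT.
Qed.
End SNeighborhood.

(** * Recursion over the cells *)

Section WellFounded.
Context (I : Type) (r : I -> I -> Prop).

(** The number of predecessors decreases strictly along [r]. *)
Lemma finite_predecessors_wf : (forall i j k, r i j -> r j k -> r i k) ->
  (forall i, ~ r i i) -> (forall i, finite_set [set j | r j i]) -> well_founded r.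
Proof.
move=> rt ri rf.
pose preds i : {fset {classic I}} := fset_set ([set j | r j i] : set {classic I}).
have predsE i j : (j \in preds i) = ((j : I) \in [set j | r j i]).
  by rewrite in_fset_set//; exact: rf.
have acc n : forall i, (#|` preds i| < n)%N -> Acc r i.
  elim: n => [i|n IH i]; first by rewrite ltn0.
  rewrite ltnS => ni.
  apply: Acc_intro => j ji; apply: IH; apply: leq_trans ni.
  apply: fproper_ltn_card; rewrite fproperEneq; apply/andP; split; last first.
    apply/fsubsetP => k; rewrite !predsE => /set_mem kj; apply/mem_set.
    exact: rt kj ji.
  apply/eqP => /fsetP/(_ (j : {classic I})); rewrite !predsE => jE.
  apply: (ri j).
  by have /set_mem : j \in [set k | r k j] by rewrite jE; apply/mem_set.
by move=> i; exact: acc (ltnSn _).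
Qed.

(** Well-founded recursion in relational form: the choice at [i] may depend on
all choices made below [i]. *)
Lemma wf_dependent_choice (T : I -> Type)
    (Q : forall i, (forall j, r j i -> T j) -> T i -> Prop) :
  well_founded r -> (forall i f, exists t, Q i f t) ->
  exists F : forall i, T i, forall i, Q i (fun j _ => F j) (F i).
Proof.
move=> rwf Qex.
pose step i f := sval (cid (Qex i f)).
exists (Fix rwf T step) => i; rewrite [X in Q _ _ X]Fix_eq.
  exact: svalP (cid (Qex i _)).
by move=> k f g fg; congr (step k _); apply/functional_extensionality_dep => j;
  apply/functional_extensionality_dep => jk; exact: fg.
Qed.
End WellFounded.

Section Cells.
Context (R : realType) (d : Order.disp_t) (P : porderType d).
Context (X : strat_space P) (X_T2 : hausdorff_space X) (I : Type).
Variable C : cell_structure R X I.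
Local Notation sim i := (realization R (simplex (cell_flag C i))).
Local Notation sdc i := (realization R (sd (cell_flag C i))).

Lemma prec_wf : well_founded (prec C).
Proof.
apply: finite_predecessors_wf.
- by move=> i j k; exact: t_trans.
- exact: prec_irreflexive (cellsP C).
- exact: prec_finite (cellsP C).
Qed.

(** The cells cover X, so a boundary point of the cell [i] is mapped into some
cell, which precedes [i] by definition of [prec]. *)
Lemma boundary_below i (x : sim i) : bnd C i x ->
  exists2 j, prec C j i & exists z : sim j, char_map C j z = char_map C i x.
Proof.
move=> bx; have [j _ [z nbz zx]] : (\bigcup_i cell C i) (char_map C i x).
  by rewrite (cell_cover (cellsP C)).
exists j; last by exists z.
by apply: t_step; exists (char_map C i x); split; [exists z|exists x].
Qed.

(** The points of the [i]-th simplex that the condition on standard neighborhoods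
allows in the image of |S(p)|, if [N j p] is the image of |S(p)| in the [j]-th
simplex. Interior points are unconstrained, so that no extension problem from
the boundary arises. *)
Definition attaching_target (N : forall j, P -> set (sim j)) i p : set (sim i) :=
  [set x | bnd C i x -> exists2 j, prec C j i &
     exists2 z, N j p z & char_map C j z = char_map C i x].

Section AttachingTarget.
Variables (N : forall j, P -> set (sim j)) (i : I).

Lemma stratum_le_attaching_target p :
  (forall j, prec C j i -> stratum_le (sim j) p `<=` N p) ->
  stratum_le (sim i) p `<=` attaching_target N (i := i) p.
Proof.
move=> Nle x xp /boundary_below[j ji [z zx]]; exists j => //; exists z => //.
apply: Nle => //; rewrite /stratum_le /mkset -(char_mapP C j).2 zx.
by rewrite (char_mapP C i).2.
Qed.

(** The points that fail to be in the target have an image in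
[char_map C j (~` (N j p)°)] for an earlier [j]. This is a finite union of
compact sets in a Hausdorff space, and it does not meet the stratum of [p]. *)
Lemma stratum_attaching_target p :
  (forall j, prec C j i -> stratum (sim j) p `<=` (N p)°) ->
  stratum (sim i) p `<=` (attaching_target N (i := i) p)°.
Proof.
move=> Nn.
pose F : set X := \bigcup_(j in [set j | prec C j i])
  (char_map C j @` (~` (N (j := j) p)°)).
have cF : closed F.
  apply: (@closed_bigcup X {classic I}); first exact: prec_finite (cellsP C) i.
  move=> j _; apply: compact_closed => //; apply: continuous_compact.
    exact: continuous_subspaceT (char_mapP C j).1.
  apply: (subclosed_compact _ (@realization_compact R _ _ _)) => //.
  by apply: open_closedC; exact: open_interior.
have oF : open (~` (char_map C i @^-1` F)).
  apply: closed_openC; have /continuous_closedP := (char_mapP C i).1; exact.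
have FN : ~` (char_map C i @^-1` F) `<=` attaching_target N (i := i) p.
  move=> x nFx /boundary_below[j ji [z zx]]; exists j => //; exists z => //.
  apply: contrapT => nNz; apply: nFx; exists j => //; exists z => //.
  exact: contra_not (@interior_subset _ _ _) nNz.
rewrite open_subsetE// in FN; move=> x xp; apply: FN => -[j ji [z nNz zx]].
apply: nNz; apply: Nn => //.
by rewrite /stratum /mkset -(char_mapP C j).2 zx (char_mapP C i).2.
Qed.
End AttachingTarget.

Lemma prec_subcomplex (D : set I) (HD : closed_below C D) (i j : D) :
  prec (subcomplex_cells HD) i j -> prec C (set_val i) (set_val j).
Proof.
elim=> {i j} [i j [y [[x bx <-] [x' bx' xx']]]|i j k _ ij _ jk]; last first.
  exact: t_trans ij jk.
apply: t_step; exists (char_map C (set_val i) x); split; first by exists x.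
exists x' => //; exact: (congr1 val xx').
Qed.

(** The targets are a family [U] in X itself: all of X if only a standard
neighborhood system is asked for, and the preimages of a neighborhood system
under a map otherwise. Without a given subcomplex, [D] is empty. *)
Lemma extend_subdivision (U : P -> set X)
    (Un : forall i p, stratum (sim i) p `<=` (char_map C i @^-1` U p)°)
    (Ule : forall p, stratum_le X p `<=` U p)
    (D : set I) (HD : closed_below C D)
    (PsiA : barycentric_subdivision (subcomplex_cells HD)) :
  standard_nbhd PsiA ->
  (forall p a, nbhd_system PsiA p a -> U p (set_val a)) ->
  exists Psi : barycentric_subdivision C,
    [/\ standard_nbhd Psi, forall p, nbhd_system Psi p `<=` U p &
        forall i : D, subdiv_map PsiA i = subdiv_map Psi (set_val i)].
Proof.
move=> PsiA_std PsiA_U.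
pose SD i := {psi : sdc i -> sim i | is_subdivision psi}.
pose N i (f : forall j, prec C j i -> SD j) j p : set (sim j) :=
  \bigcup_(ji in [set: prec C j i])
    sval (f j ji) @` subrealization (S_simplex (cell_flag C j) p).
pose Q i (f : forall j, prec C j i -> SD j) (psi : SD i) :=
  (forall Di : i \in D, sval psi = subdiv_map PsiA (exist _ i Di)) /\
  (~ D i -> forall p, sval psi @` subrealization (S_simplex (cell_flag C i) p)
    `<=` char_map C i @^-1` U p `&` attaching_target (N i f) (i := i) p).
have Qex i f : exists psi, Q i f psi.
  have [Di|nDi] := pselect (D i).
    pose i' : D := exist _ i (mem_set Di).
    have iP : is_subdivision (subdiv_map PsiA i').
      split; [exact: subdiv_map_strat|exact: subdiv_map_homeo|exact: subdiv_map_face].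
    exists (exist _ (subdiv_map PsiA i') iP); split=> // Di' /=.
    by rewrite /i' (Prop_irrelevance (mem_set Di) Di').
  (* [N] sees [f j] only through a proof of [prec C j i], so it is compared with
     the image for one such proof. *)
  have Nj j p : prec C j i -> exists ji : prec C j i,
      sval (f j ji) @` subrealization (S_simplex (cell_flag C j) p)
        `<=` N i f j p.
    by move=> ji; exists ji => x ?; exists ji.
  have [||psi psiP psiS] := @exists_subdivision_into R d P (cell_flag C i)
    (fun p => char_map C i @^-1` U p `&` attaching_target (N i f) (i := i) p).
  - move=> p x xp; rewrite interiorI; split; first exact: Un.
    apply: stratum_attaching_target xp => j ji y yp.
    have [ji' sub] := Nj j p ji; apply: (interiorS sub).
    exact: subdivision_S_nbhd (svalP (f j ji')) _ _ yp.
  - move=> p x xp; split.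
      by apply: Ule; rewrite /stratum_le /mkset (char_mapP C i).2.
    apply: stratum_le_attaching_target xp => j ji y yp.
    have [ji' sub] := Nj j p ji; apply: sub.
    exact: stratum_le_subdivision_S (svalP (f j ji')) _ _ yp.
  exists (exist _ psi psiP); split=> // Di; exfalso; exact/nDi/set_mem.
(* Chosen as prescribed on [D], and inside the target elsewhere. *)
have [Psi0 Psi0P] := wf_dependent_choice prec_wf Qex.
pose Psi : barycentric_subdivision C := BarycentricSubdivision
  (fun i => is_subdivision_strat (svalP (Psi0 i)))
  (fun i => is_subdivision_homeo (svalP (Psi0 i)))
  (fun i => is_subdivision_face (svalP (Psi0 i))).
have PsiD (i : D) : subdiv_map PsiA i = subdiv_map Psi (set_val i).
  by case: i => i Di; have [/(_ Di)] := Psi0P i.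
have charD (i : D) w : set_val (subcomplex_char_map HD (subdiv_map PsiA i w)) =
    char_map C (set_val i) (subdiv_map Psi (set_val i) w).
  exact: (congr1 (fun g => char_map C (set_val i) (g w)) (PsiD i)).
have S_imageD (i : D) p a :
    S_image PsiA p i a -> S_image Psi p (set_val i) (set_val a).
  by move=> [w Sw <-]; exists w => //; exact: esym (charD i w).
exists Psi; split=> //.
- move=> p i x; have [Di|nDi] := pselect (D i).
    pose i' : D := exist _ i (mem_set Di).
    move=> [w Sw <-].
    have [|j ji ja] := PsiA_std p i'
      (subcomplex_char_map HD (subdiv_map PsiA i' w)).
      by exists w.
    exists (set_val j); first exact: prec_subcomplex ji.
    have -> : (char_map C i \o subdiv_map Psi i) w = _ := esym (charD i' w).
    exact: S_imageD.
  move=> [w Sw <-].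
  have [_ /(_ nDi p)/(_ (sval (Psi0 i) w))[]] := Psi0P i.
    exists w => //.
    by move: Sw; rewrite /subrealization/= finset.in_setI => /andP[].
  move=> _ [|j ji [z [ji' _ [v Sv vz]] zw]].
    exact: (subdivision_boundary (svalP (Psi0 i)) Sw).
  by exists j => //; exists v => //=; rewrite vz.
- move=> p x [i _ [w Sw <-]]; have [Di|nDi] := pselect (D i).
    pose i' : D := exist _ i (mem_set Di).
    have -> : (char_map C i \o subdiv_map Psi i) w = _ := esym (charD i' w).
    by apply: PsiA_U; exists i' => //; exists w.
  have [_ /(_ nDi p)/(_ (sval (Psi0 i) w))[]//] := Psi0P i.
Qed.
End Cells.

Theorem proposition2p2p11 (R : realType) (d : Order.disp_t) (P : porderType d)
    (Top : top_category) (X : strat_space P) (I : Type)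
    (C : cell_structure R X I)
    (X_Top : in_Top R Top X) (X_T2 : hausdorff_space X) :
  (exists Psi : barycentric_subdivision C, standard_nbhd Psi) /\
  (forall (Y : strat_space P) (UY : P -> set Y) (f : X -> Y),
     in_Top R Top Y -> strata_nbhd_system R UY -> stratum_preserving f ->
     (exists Psi : barycentric_subdivision C,
        standard_nbhd Psi /\ lifts (nbhd_system Psi) UY f) /\
     (forall (D : set I) (HD : closed_below C D)
         (PsiA : barycentric_subdivision (subcomplex_cells HD)),
       standard_nbhd PsiA ->
       lifts (nbhd_system PsiA) UY (fun a : subcomplex C D => f (set_val a)) ->
       exists Psi : barycentric_subdivision C,
         [/\ standard_nbhd Psi, lifts (nbhd_system Psi) UY f &
             forall i : D, subdiv_map PsiA i = subdiv_map Psi (set_val i)])).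
Proof.
(* The empty subcomplex carries a subdivision and prescribes nothing. *)
have no_cell (i : (set0 : set I)) : False by have := set_valP i.
have H0 : closed_below C set0 by [].
pose Psi0 : barycentric_subdivision (subcomplex_cells H0) :=
  @BarycentricSubdivision _ _ _ _ _ _ (fun i => False_rect _ (no_cell i))
    (fun i => False_ind _ (no_cell i)) (fun i => False_ind _ (no_cell i))
    (fun i => False_ind _ (no_cell i)).
have Psi0_std : standard_nbhd Psi0 by move=> p i; case: (no_cell i).
have Psi0_U (U : P -> set X) p a : nbhd_system Psi0 p a -> U p (set_val a).
  by move=> [i]; case: (no_cell i).
split.
  have [||Psi [Psi_std _ _]] := extend_subdivision X_T2 (U := fun=> setT) _ _
    Psi0_std (Psi0_U _).
  - by move=> i p x _; rewrite preimage_setT interiorT.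
  - by [].
  by exists Psi.
move=> Y UY f _ UYn [cf fs].
pose U p := f @^-1` UY p.
have Un i p : stratum (realization R (simplex (cell_flag C i))) p `<=`
    (char_map C i @^-1` U p)°.
  have [cs ss] := char_mapP C i.
  move=> x xp; apply: ((UYn p).1 _ (f \o char_map C i)).
    split=> [y|y]; first by apply: continuous_comp; [exact: cs|exact: cf].
    by rewrite /= fs ss.
  by rewrite /stratum /mkset /= fs ss.
have Ule p : stratum_le X p `<=` U p.
  by move=> x xp; apply: (UYn p).2; rewrite /stratum_le /mkset fs.
have lifts_of (Psi : barycentric_subdivision C) :
    (forall p, nbhd_system Psi p `<=` U p) -> lifts (nbhd_system Psi) UY f.
  by move=> PsiU p _ [x /PsiU Ux <-].
split.
  have [Psi [Psi_std PsiU _]] :=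
    extend_subdivision X_T2 Un Ule Psi0_std (Psi0_U _).
  by exists Psi; split=> //; exact: lifts_of.
move=> D HD PsiA PsiA_std PsiA_lifts.
have [|Psi [Psi_std PsiU PsiD]] := extend_subdivision X_T2 Un Ule PsiA_std.
  by move=> p a pa; apply: PsiA_lifts; exists a.
by exists Psi; split=> //; exact: lifts_of.
Qed.
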